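(* Let $T,B:\mathfrak H\to\mathfrak K$ be closed densely defined linear operators such that $B^*T$ is selfadjoint and $\overline{B_0}=B^*$, where $B_0:=B^*\cap(\mathfrak K\times\mathrm{ran}\,B^*T)$. If $\overline{\mathrm{ran}}\,T=\overline{\mathrm{ran}}\,B=\mathfrak K$, then the following assertions are equivalent: (i) $T^*T\ge\eta\,B^*T\ge0$ for some $\eta>0$, with $\mathrm{ran}\,T^*\subseteq\mathrm{ran}\,B^*$; (ii) $T^*=B^*Y$ has a solution $Y$ with $Y^{-1}\in B^+(\mathfrak K)$.
   Context: $\mathfrak H,\mathfrak K$ are complex Hilbert spaces; $B^+(\mathfrak K)$ is the set of bounded everywhere defined nonnegative selfadjoint operators on $\mathfrak K$. Operators are identified with their graphs, so $B_0$ is the restriction of $B^*$ to those $k\in\mathrm{dom}\,B^*$ with $B^*k\in\mathrm{ran}\,B^*T$, and $\overline{B_0}$ is its closure. Products have their natural domains. $Y$ is in general a linear relation in $\mathfrak K$ (a linear subspace of $\mathfrak K\times\mathfrak K$) whose inverse is an operator in $B^+(\mathfrak K)$. For nonnegative selfadjoint operators $C,D$, $C\ge D$ means $\mathrm{dom}\,C^{1/2}\subseteq\mathrm{dom}\,D^{1/2}$ and $\|D^{1/2}x\|\le\|C^{1/2}x\|$ for all $x\in\mathrm{dom}\,C^{1/2}$; writing such an inequality includes the assertion that $C$ and $D$ are nonnegative and selfadjoint. *)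

(* Defs.v *)
From HB Require Import structures.
From mathcomp Require Import all_boot all_order all_algebra.
From mathcomp Require Import complex.
From mathcomp Require Import all_classical all_reals all_analysis.
Import Order.TTheory GRing.Theory Num.Theory.
Import numFieldNormedType.Exports.

Set Implicit Arguments.
Unset Strict Implicit.
Unset Printing Implicit Defensive.

Local Open Scope classical_set_scope.
Local Open Scope ring_scope.

(* A complex Hilbert space is a complete normed module over R[i] whose norm is
   induced by an inner product (linear in its first argument). *)
HB.mixin Record NormedModule_isHilbert (R : realType) V
    of CompleteNormedModule R[i] V := {
  inner : {dot V for (@Num.conj R[i])} ;
  inner_norm : forall u : V, inner u u = `|u| ^+ 2
}.

#[short(type="hilbertType")]
HB.structure Definition Hilbert (R : realType) :=
  {V of CompleteNormedModule R[i] V & NormedModule_isHilbert R V}.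

(* Operators and linear relations from U to V are subsets of U * V: an operator
   is identified with its graph.  Composition and inverse are those of
   relation_scope; [A \; B] is the product AB, with B applied first. *)
Section LinearRelations.
Variables (R : realType) (U V : hilbertType R).
Implicit Types A : set (U * V).

Definition dom A : set U := fst @` A.
Definition ran A : set V := snd @` A.

Definition linear_relation A :=
  A (0, 0) /\ forall (c : R[i]) p q, A p -> A q -> A (c *: p + q).

Definition operator A := linear_relation A /\ forall y, A (0, y) -> y = 0.

Definition adjoint A : set (V * U) :=
  [set kh | forall x y, A (x, y) -> inner y kh.1 = inner x kh.2].

Definition scale_op (c : R[i]) A : set (U * V) :=
  [set (xy.1, c *: xy.2) | xy in A].

Definition zero_op : set (U * V) := [set xy | xy.2 = 0].

Definition bounded_op A :=
  exists M : R, forall x y, A (x, y) -> `|y| <= (M%:C)%C * `|x|.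

Definition closed_densely_defined A :=
  [/\ operator A, closed A & dense (dom A)].

End LinearRelations.

Section Order.
Variables (R : realType) (V : hilbertType R).
Implicit Types A C D : set (V * V).

Definition selfadjoint A := [/\ operator A, dense (dom A) & adjoint A = A].

(* In R[i], [0 <= z] means that z is real and nonnegative. *)
Definition nonnegative A := forall x y, A (x, y) -> 0 <= inner y x.

Definition nonneg_selfadjoint A := nonnegative A /\ selfadjoint A.

(* C^{1/2}: the nonnegative selfadjoint operator whose square is C; it exists
   and is unique when C is nonnegative and selfadjoint (set0 is returned when
   there is no such operator). *)
Definition sqrt_op C : set (V * V) :=
  xget set0 [set S | nonneg_selfadjoint S /\ (S \; S)%relation = C].

Definition op_ge C D :=
  [/\ nonneg_selfadjoint C, nonneg_selfadjoint D,
      dom (sqrt_op C) `<=` dom (sqrt_op D) &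
      forall x y z, sqrt_op C (x, y) -> sqrt_op D (x, z) -> `|z| <= `|y|].

Definition Bplus A :=
  [/\ dom A = [set: V], bounded_op A & nonneg_selfadjoint A].

End Order.

Arguments zero_op {R U V}.

(* Main.v *)
From HB Require Import structures.
Require Import Defs.
From mathcomp Require Import all_boot all_order all_algebra.
From mathcomp Require Import complex ring lra.
From mathcomp Require Import all_classical all_reals all_analysis.
Import Order.TTheory GRing.Theory Num.Theory.
Import numFieldNormedType.Exports.

Set Implicit Arguments.
Unset Strict Implicit.
Unset Printing Implicit Defensive.

Local Open Scope classical_set_scope.
Local Open Scope ring_scope.

(** Write A for the selfadjoint operator B^* T.  The equivalence rests on
    reading each inequality between selfadjoint operators as an inequality
    between quadratic forms.

    Form domains.  For a closed operator S, a vector x lies in dom S with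
    |S x|^2 <= c exactly when 2 Re <w, x> <= <w, y> + c for all (y, w) in S^* S
    ([form_bound], [form_domain]).  The right-hand side mentions S only through
    S^* S, so for a nonnegative selfadjoint C it describes the domain and the
    norm of C^{1/2} from C alone, and it shows that T and (T^* T)^{1/2} have the
    same domain and the same norms.  Then [op_ge C D] just says that every x in
    dom C^{1/2} is in dom D^{1/2} with |D^{1/2} x| <= |C^{1/2} x| ([op_geP]).
    That these roots exist is [sqrt_exists]: the resolvent J = (1 + C)^{-1}
    satisfies 0 <= J <= 1, the bounded roots Q = J^{1/2} and P = (1 - J)^{1/2}
    exist by a fixed point iteration ([bounded_sqrt]), and the relation of all
    pairs (Q u, P u) is the root of C.

    A factorization gives the inequality ([factor_dominates]).  Let X = Y^{-1}.
    Taking adjoints in T^* = B^* Y shows that (x, X T x) belongs to B for x in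
    dom T.  Hence <A x, x'> = <X T x, T x'>, so A is nonnegative, and as X is
    bounded its form is dominated by that of T^* T.

    The inequality gives a factorization ([dominated_factor]).  With
    D = eta A, the map T x |-> D^{1/2} x is a contraction G on the dense subspace
    ran T, and G^* G^{**} is a bounded nonnegative operator ([contraction_square]).
    Put X = eta^{-1} G^* G^{**}.  Then (X T x, A x) belongs to T^* for x in
    dom A.  Since B^* is injective, B_0 is B^* restricted to T (dom A), so
    closedness of T^* X and the core hypothesis give: (X k, B^* k) is in T^* for
    every k in dom B^*.  The inclusion of ran T^* in ran B^* and injectivity of
    T^* show that all of T^* is obtained in this way, that is T^* = B^* X^{-1}.

    All existence statements about vectors come from one minimisation argument,
    a Riesz representation theorem for functionals defined on a subspace that
    need not be closed ([riesz_pair]). *)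

(** * Real parts of inner products *)
Section ComplexParts.
Variable R : realType.
Implicit Types a b : R[i].

Lemma ReD a b : complex.Re (a + b) = complex.Re a + complex.Re b.
Proof. by case: a; case: b. Qed.
Lemma ReN a : complex.Re (- a) = - complex.Re a.
Proof. by case: a. Qed.
Lemma ReZ (t : R) a : complex.Re ((t%:C)%C * a) = t * complex.Re a.
Proof. by case: a => u v /=; rewrite mul0r subr0. Qed.
Lemma Re_conj a : complex.Re (a^*) = complex.Re a.
Proof. by case: a. Qed.
Lemma Re_mulNi a : complex.Re (('i : R[i])%C * a) = - complex.Im a.
Proof. by case: a => u v /=; rewrite mul0r sub0r mul1r. Qed.

(** Inner products are linear on the left, so an identity between them follows
    from its real part, taken once as it is and once for 'i times the left
    vector. *)
Lemma eq_complex_Re a b : complex.Re a = complex.Re b ->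
  complex.Re (('i : R[i])%C * a) = complex.Re (('i : R[i])%C * b) -> a = b.
Proof.
by rewrite !Re_mulNi => e /oppr_inj f; case: a b e f => [? ?] [? ?] /= -> ->.
Qed.
End ComplexParts.

Section RealInner.
Variables (R : realType) (V : hilbertType R).
Implicit Types (x y z : V) (t : R).

Lemma innerC x y : inner y x = (inner x y)^*.
Proof. by rewrite (hermC (inner : {dot V for _})) /= expr0 mul1r. Qed.
Lemma innerC0 x y : inner x y = 0 -> inner y x = 0.
Proof. by move=> h; rewrite innerC h conjC0. Qed.
Lemma innerC_ge0 x y : 0 <= inner x y -> 0 <= inner y x.
Proof. by rewrite [inner y x]innerC conjC_ge0. Qed.
Lemma innerDl x y z : inner (x + y) z = inner x z + inner y z.
Proof. exact: linearDl. Qed.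
Lemma innerDr x y z : inner z (x + y) = inner z x + inner z y.
Proof. exact: linearDr. Qed.
Lemma innerNl x z : inner (- x) z = - inner x z.
Proof. exact: linearNl. Qed.
Lemma innerNr x z : inner z (- x) = - inner z x.
Proof. exact: linearNr. Qed.
Lemma inner0l x : inner 0 x = 0.
Proof. exact: linear0l. Qed.
Lemma inner0r x : inner x 0 = 0.
Proof. exact: linear0r. Qed.
Lemma innerZl (c : R[i]) x y : inner (c *: x) y = c * inner x y.
Proof. exact: linearZl_LR. Qed.
Lemma innerZr (c : R[i]) x y : inner y (c *: x) = c^* * inner y x.
Proof. exact: linearZr_LR. Qed.
Lemma innerZrr t x y : inner y ((t%:C)%C *: x) = ((t%:C)%C) * inner y x.
Proof. by rewrite innerZr; congr (_ * _); exact: conjc_real. Qed.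

(** V seen as a real inner product space, in which estimates between inner
    products become inequalities between real numbers. *)
Definition rip x y : R := complex.Re (inner x y).
Definition nsq x : R := rip x x.

Lemma ripC x y : rip y x = rip x y.
Proof. by rewrite /rip innerC Re_conj. Qed.
Lemma ripDl x y z : rip (x + y) z = rip x z + rip y z.
Proof. by rewrite /rip innerDl ReD. Qed.
Lemma ripDr x y z : rip z (x + y) = rip z x + rip z y.
Proof. by rewrite ripC ripDl !(ripC z). Qed.
Lemma ripNl x z : rip (- x) z = - rip x z.
Proof. by rewrite /rip innerNl ReN. Qed.
Lemma ripNr x z : rip z (- x) = - rip z x.
Proof. by rewrite ripC ripNl ripC. Qed.
Lemma rip0l x : rip 0 x = 0.
Proof. by rewrite /rip inner0l. Qed.
Lemma rip0r x : rip x 0 = 0.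
Proof. by rewrite ripC rip0l. Qed.
Lemma ripZl t x y : rip ((t%:C)%C *: x) y = t * rip x y.
Proof. by rewrite /rip innerZl ReZ. Qed.
Lemma ripZr t x y : rip y ((t%:C)%C *: x) = t * rip y x.
Proof. by rewrite ripC ripZl ripC. Qed.

Definition ripE := (ripDl, ripDr, ripNl, ripNr, rip0l, rip0r, ripZl, ripZr).

Lemma inner_nsq x : inner x x = ((nsq x)%:C)%C.
Proof.
rewrite /nsq /rip.
have: 0 <= inner x x by rewrite inner_norm exprn_ge0.
by case: (inner x x) => u v; rewrite lecE /= => /andP[/eqP -> _].
Qed.

Lemma norm_nsq x : `|x| ^+ 2 = ((nsq x)%:C)%C.
Proof. by rewrite -inner_norm inner_nsq. Qed.

Lemma nsq_ge0 x : 0 <= nsq x.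
Proof. by rewrite -ler0c -norm_nsq exprn_ge0. Qed.

Lemma nsq0 : nsq 0 = 0 :> R.
Proof. by rewrite /nsq rip0l. Qed.

Lemma nsq_eq0 x : nsq x = 0 -> x = 0.
Proof.
move=> h; apply/normr0_eq0/eqP.
by rewrite -sqrf_eq0 norm_nsq h.
Qed.

Lemma nsq_le0 x : nsq x <= 0 -> x = 0.
Proof. by move=> h; apply: nsq_eq0; apply/le_anti; rewrite h nsq_ge0. Qed.

Lemma nsqN x : nsq (- x) = nsq x.
Proof. by rewrite /nsq !ripE opprK. Qed.

Lemma nsqB x y : nsq (x - y) = nsq (y - x).
Proof. by rewrite -nsqN opprB. Qed.

(** The Cauchy-Schwarz inequality in a form that is linear in the squared norms,
    so that it combines with the other estimates without square roots. *)
Lemma rip_le2 x y : 2 * rip x y <= nsq x + nsq y.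
Proof. have := nsq_ge0 (x - y); rewrite /nsq !ripE (ripC x y); lra. Qed.

End RealInner.

(** * Closures and completeness in terms of squared norms *)
Section Topology.
Variable R : realType.
Implicit Types U V W : hilbertType R.

Lemma le_norm_nsq V W (x : V) (w : W) : (`|x| <= `|w|) = (nsq x <= nsq w).
Proof. by rewrite -lecR -!norm_nsq ler_pXn2r ?nnegrE. Qed.

Lemma gt0_complex (e : R[i]) : 0 < e -> exists2 r : R, 0 < r & e = (r%:C)%C.
Proof.
case: e => r s; rewrite ltcE /= => /andP[/eqP -> r0].
by exists r.
Qed.

Lemma ball_nsq V (x y : V) (r : R) : 0 < r ->
  ball x ((r%:C)%C) y <-> nsq (x - y) < r ^+ 2.
Proof.
move=> r0; rewrite -ball_normE /ball_ /= -ltcR -norm_nsq rmorphXn /=.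
by rewrite ltr_pXn2r ?nnegrE // ler0c ltW.
Qed.

Lemma closure_nsqP V (D : set V) x :
  closure D x <-> forall e : R, 0 < e -> exists2 y, D y & nsq (x - y) < e.
Proof.
split=> [cD e e0|cD B /nbhs_ballP[e /= /gt0_complex[r r0 ->] sB]].
  have [|y [Dy yB]] := cD (ball x (((Num.sqrt e)%:C)%C)).
    by apply: nbhsx_ballx; rewrite ltcR sqrtr_gt0.
  exists y => //; move/ball_nsq: yB; rewrite sqrtr_gt0 sqr_sqrtr ?(ltW e0) //.
  exact.
have [|y Dy yr] := cD (r ^+ 2); first by rewrite exprn_gt0.
by exists y; split=> //; apply/sB/ball_nsq.
Qed.

Lemma closure_nsq2P U V (D : set (U * V)) p :
  closure D p <-> forall e : R, 0 < e ->
    exists2 q, D q & nsq (p.1 - q.1) + nsq (p.2 - q.2) < e.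
Proof.
split=> [cD e e0|cD B /nbhs_ballP[e /= /gt0_complex[r r0 ->] sB]].
  have h0 : 0 < Num.sqrt (e / 2) by rewrite sqrtr_gt0 divr_gt0.
  have [|q [Dq [q1 q2]]] := cD (ball p (((Num.sqrt (e / 2))%:C)%C)).
    by apply: nbhsx_ballx; rewrite ltcR.
  exists q => //; move/ball_nsq: q1 => /(_ h0); move/ball_nsq: q2 => /(_ h0).
  by rewrite sqr_sqrtr; lra.
have [|q Dq qr] := cD (r ^+ 2); first by rewrite exprn_gt0.
exists q; split=> //; apply/sB; split; apply/ball_nsq => //.
  by have := nsq_ge0 (p.2 - q.2); lra.
by have := nsq_ge0 (p.1 - q.1); lra.
Qed.

Lemma nsq_complete V (u : nat -> V) :
  (forall e : R, 0 < e -> exists N, forall m n, (N <= m)%N -> (N <= n)%N ->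
    nsq (u m - u n) < e) ->
  exists l, forall e : R, 0 < e -> exists N, forall n, (N <= n)%N ->
    nsq (u n - l) < e.
Proof.
move=> cu.
have : cauchy (u @ \oo).
  apply/cauchy_ballP => _ /gt0_complex[r r0 ->].
  have [|N HN] := cu (r ^+ 2); first by rewrite exprn_gt0.
  exists (u @` [set n | (N <= n)%N], u @` [set n | (N <= n)%N]) => /=.
    by split; exists N => // n Nn; exists n.
  by move=> _ /= [[m Nm <-] [n Nn <-]]; apply/ball_nsq => //; exact: HN.
move/cauchy_cvg => /cvg_ex[/= l ul]; exists l => e e0.
have h0 : 0 < Num.sqrt e by rewrite sqrtr_gt0.
have /ul[N _ HN] : nbhs l (ball l (((Num.sqrt e)%:C)%C)).
  by apply: nbhsx_ballx; rewrite ltcR.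
exists N => n /HN /= /ball_nsq; rewrite nsqB sqr_sqrtr; first exact.
exact: ltW.
Qed.

Lemma dense_closureP V (D : set V) : dense D <-> forall x, closure D x.
Proof.
split=> [dD x|cD O [x Ox] oO].
  move=> B; rewrite nbhsE => - [W [oW Wx] sB].
  have [y [Wy Dy]] := dD W (ex_intro _ x Wx) oW.
  by exists y; split=> //; apply: sB.
have [y [Dy Oy]] := cD x O (open_nbhs_nbhs (conj oO Ox)).
by exists y.
Qed.

End Topology.

(** * Riesz representation by minimisation *)
Lemma invS_lt (R : realType) (e : R) : 0 < e ->
  exists N, forall n, (N <= n)%N -> n.+1%:R^-1 < e.
Proof.
move=> e0; exists (Num.truncn e^-1) => n Nn.
rewrite invf_plt ?posrE //; apply: lt_le_trans (truncnS_gt _) _.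
by rewrite ler_nat.
Qed.

(** The first variation argument: a parabola through 0 that stays nonnegative has
    slope 0 there.  The error e absorbs the fact that a minimiser is
    known only through approximations. *)
Lemma quadratic_ge0 (R : realType) (a d : R) : 0 <= a ->
  (forall t e, 0 < e -> 0 <= t ^+ 2 * a + t * d + e) -> d = 0.
Proof.
move=> a0 h; apply/eqP/negPn/negP => d0.
have a1 : 0 < a + 1 by lra.
pose t := - d / (a + 1).
have td : t * (a + 1) = - d by rewrite divfK // gt_eqF.
have t2 : 0 < t ^+ 2.
  by rewrite exprn_even_gt0 //= mulf_neq0 ?oppr_eq0 // invr_eq0 gt_eqF.
have /(h t) : 0 < t ^+ 2 / 2 by rewrite divr_gt0.
have -> : d = - (t * (a + 1)) by rewrite td opprK.
by rewrite expr2 in t2 *; nra.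
Qed.

Section RieszPair.
Variables (R : realType) (U V : hilbertType R).
Let rip2 (p q : U * V) := rip p.1 q.1 + rip p.2 q.2.
Let nsq2 (p : U * V) := nsq p.1 + nsq p.2.

(** [G] is the graph of a linear functional phi on a subspace of U * V, closed or
    not, and [v] represents phi.  It is the limit of a minimising sequence for
    J p = |p|^2 - 2 Re phi(p): the third premise bounds J below by - c, the
    parallelogram law makes the sequence Cauchy, and the first variation of J is
    2 Re (<k, p> - phi(k)).  If phi has norm at most M then the premise holds with
    c = M^2.  The pair space is used because the projection of a point onto the
    graph of an operator is one of the instances. *)
Lemma riesz_pair (G : set ((U * V) * R[i])) (c : R) :
  G (0, 0) ->
  (forall (a : R[i]) p q, G p -> G q -> G (a *: p.1 + q.1, a * p.2 + q.2)) ->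
  (forall p, G p -> 2 * complex.Re p.2 <= nsq p.1.1 + nsq p.1.2 + c) ->
  exists v, [/\ closure [set p.1 | p in G] v,
    forall p, G p -> inner p.1.1 v.1 + inner p.1.2 v.2 = p.2 &
    nsq v.1 + nsq v.2 <= c].
Proof.
move=> G0 Glin Gc.
pose J (p : (U * V) * R[i]) := nsq2 p.1 - 2 * complex.Re p.2.
pose m := inf [set J p | p in G].
have hJ : has_inf [set J p | p in G].
  split; first by exists (J (0, 0)), (0, 0).
  by exists (- c) => _ [p /Gc pc <-]; rewrite /J /nsq2; lra.
have Jm p : G p -> m <= J p by move=> Gp; apply: ge_inf; [case: hJ | exists p].
(* All the geometry used below: J at a real combination s p + t q.  Midpoints
   (s = t = 1/2) give the Cauchy property, and s = 1 the first variation. *)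
have Jm2 (s t : R) p q : G p -> G q ->
    m <= s ^+ 2 * nsq2 p.1 + t ^+ 2 * nsq2 q.1 + 2 * s * t * rip2 p.1 q.1
         - 2 * (s * complex.Re p.2 + t * complex.Re q.2).
  move=> Gp Gq; have := Glin (t%:C)%C _ _ Gq G0.
  move=> /(Glin (s%:C)%C _ _ Gp)/Jm /le_trans; apply.
  rewrite /J /= !addr0 !ReD !ReZ /nsq2 /rip2 /nsq /= !ripE.
  rewrite (ripC p.1.1) (ripC p.1.2) le_eqVlt; apply/orP; left; apply/eqP.
  by ring.
have para p q : G p -> G q ->
    nsq2 (p.1 - q.1) <= 2 * (J p + J q) - 4 * m.
  move=> Gp Gq; have := Jm2 2^-1 2^-1 _ _ Gp Gq.
  by rewrite /J /nsq2 /rip2 /= /nsq !ripE (ripC p.1.1) (ripC p.1.2); lra.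
have /choice[u uP] (n : nat) : exists p, G p /\ J p < m + n.+1%:R^-1.
  have [|_ [p Gp <-] pm] := @inf_adherent _ _ (n.+1%:R^-1) _ hJ.
    by rewrite invr_gt0.
  by exists p.
have cu (e : R) : 0 < e -> exists N, forall i j, (N <= i)%N -> (N <= j)%N ->
    nsq2 ((u i).1 - (u j).1) < e.
  move=> e0; have [|N HN] := @invS_lt R (e / 4); first by rewrite divr_gt0.
  exists N => i j /HN Ni /HN Nj.
  have [Gi ui] := uP i; have [Gj uj] := uP j.
  have := para _ _ Gi Gj; move: ui uj Ni Nj.
  by move: (i.+1%:R^-1) (j.+1%:R^-1) => a b; lra.
have [|l1 ul1] := @nsq_complete _ _ (fun n => (u n).1.1).
  move=> e /cu[N HN]; exists N => i j Ni Nj; apply: le_lt_trans (HN i j Ni Nj).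
  by rewrite lerDl nsq_ge0.
have [|l2 ul2] := @nsq_complete _ _ (fun n => (u n).1.2).
  move=> e /cu[N HN]; exists N => i j Ni Nj; apply: le_lt_trans (HN i j Ni Nj).
  by rewrite lerDr nsq_ge0.
pose v := (l1, l2).
have approx (e : R) : 0 < e -> exists p, [/\ G p, nsq2 (p.1 - v) < e & J p < m + e].
  move=> e0; have e2 : 0 < e / 2 by rewrite divr_gt0.
  have [N1 /(_ _ (leq_trans (leq_maxl _ _) (leq_maxl _ _))) h1] := ul1 _ e2.
  have [N2 /(_ _ (leq_trans (leq_maxr _ _) (leq_maxl _ _))) h2] := ul2 _ e2.
  have [N3 /(_ _ (leq_maxr _ _)) h3] := invS_lt e0.
  have [Gp up] := uP (maxn (maxn N1 N2) N3).
  exists (u (maxn (maxn N1 N2) N3)); split=> //; last first.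
    by move: up (h3 (maxn N1 N2)); move: (_.+1%:R^-1) => a; lra.
  by have := h1 N2 N3; have := h2 N1 N3; rewrite /nsq2 /=; lra.
have Rev k : G k -> rip2 k.1 v = complex.Re k.2.
  move=> Gk; apply/eqP; rewrite -subr_eq0; apply/eqP.
  apply: (@quadratic_ge0 _ (nsq2 k.1)); first by rewrite addr_ge0 ?nsq_ge0.
  move=> t e /approx[p [Gp pv pm]].
  have := Jm2 1 t _ _ Gp Gk.
  have := nsq_ge0 ((t%:C)%C *: k.1.1 - (p.1.1 - v.1)).
  have := nsq_ge0 ((t%:C)%C *: k.1.2 - (p.1.2 - v.2)).
  move: pv pm; rewrite /J /nsq2 /rip2 /nsq /= !ripE.
  rewrite !(ripC k.1.1) !(ripC k.1.2) (ripC p.1.1 l1) (ripC p.1.2 l2).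
  by lra.
exists v; split.
- apply/closure_nsq2P => e /approx[p [Gp pv _]]; exists p.1; first by exists p.
  by rewrite nsqB (nsqB v.2).
- move=> k Gk; apply: eq_complex_Re; first by rewrite ReD; exact: Rev.
  have /Rev := Glin 'i%C _ _ Gk G0.
  by rewrite /= !addr0 /rip2 /rip /= !innerZl -ReD mulrDr.
- apply/ler_addgt0Pr => e /approx[p [Gp pv _]].
  have := Rev _ Gp; have := Gc _ Gp; move: pv.
  rewrite /nsq2 /rip2 /nsq /= !ripE (ripC p.1.1 l1) (ripC p.1.2 l2).
  by lra.
Qed.
End RieszPair.

(** * Square roots of bounded operators *)
Section RealNorm.
Variables (R : realType) (V : hilbertType R).
Implicit Types (x y : V) (t : R).

(** The norm of V takes its values in R[i]; this is the same number in R. *)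
Definition nrm x : R := complex.Re `|x|.

Lemma norm_nrm x : `|x| = ((nrm x)%:C)%C.
Proof.
rewrite /nrm; have := normr_ge0 x.
by case: `|x| => u v; rewrite lecE => /andP[/eqP /= ->].
Qed.
Lemma nrm_ge0 x : 0 <= nrm x.
Proof. by rewrite -ler0c -norm_nrm. Qed.
Lemma nrm_sq x : nrm x ^+ 2 = nsq x.
Proof. by apply: complexI; rewrite -norm_nsq norm_nrm rmorphXn. Qed.
Lemma nrmD x y : nrm (x + y) <= nrm x + nrm y.
Proof. by rewrite -lecR rmorphD /= -!norm_nrm ler_normD. Qed.
Lemma nrmN x : nrm (- x) = nrm x.
Proof. by rewrite /nrm normrN. Qed.
Lemma nrmB x y : nrm (x - y) = nrm (y - x).
Proof. by rewrite -nrmN opprB. Qed.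
Lemma nrmZ (c : R[i]) x : nrm (c *: x) = complex.Re `|c| * nrm x.
Proof.
rewrite /nrm normrZ [`|x|]norm_nrm.
by case: `|c| => u v /=; rewrite mulr0 subr0.
Qed.
Lemma nrmZr t x : 0 <= t -> nrm ((t%:C)%C *: x) = t * nrm x.
Proof. by move=> t0; rewrite nrmZ ger0_norm ?ler0c. Qed.
Lemma nrm_le0 x : nrm x <= 0 -> x = 0.
Proof.
move=> x0; apply: nsq_le0; rewrite -nrm_sq.
by have := nrm_ge0 x; nra.
Qed.
Lemma nrm0 : nrm 0 = 0.
Proof. by rewrite /nrm normr0. Qed.

Lemma rip_cauchy_schwarz x y : `|rip x y| <= nrm x * nrm y.
Proof.
rewrite -(@ler_pXn2r _ 2) ?nnegrE ?normr_ge0 ?mulr_ge0 ?nrm_ge0 //.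
rewrite real_normK ?num_real // exprMn !nrm_sq.
have [y0|y0] := eqVneq (nsq y) 0.
  by rewrite y0 (nsq_eq0 y0) rip0r expr0n mulr0.
have yp : 0 < nsq y by rewrite lt_neqAle eq_sym y0 nsq_ge0.
rewrite -subr_ge0 -(pmulr_rge0 _ yp).
have := nsq_ge0 (((nsq y)%:C)%C *: x - ((rip x y)%:C)%C *: y).
rewrite {1}/nsq !ripE (ripC x y) -!/(nsq _) => h.
by apply: le_trans h _; rewrite le_eqVlt; apply/orP; left; apply/eqP; ring.
Qed.
End RealNorm.

Section SquareRoot.
Variables (R : realType) (V : hilbertType R).

Definition symmetric_map (A : V -> V) := forall x y, inner (A x) y = inner x (A y).

(** The scalar iteration z' = (1 + z^2) / 2 from z = 0 increases to 1 and
    dominates the operator iteration [sqrt_iter] term by term; [sqrt_err] is the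
    distance 1 - z, which therefore bounds the error of [sqrt_iter]. *)
Fixpoint sqrt_err (n : nat) : R :=
  if n is n'.+1 then sqrt_err n' - sqrt_err n' ^+ 2 / 2 else 1.

(** The map e |-> e - e^2 / 2 is increasing on [0, 1] and sends 2 / a below
    2 / (a + 1). *)
Lemma sqrt_err_bound n : 0 <= sqrt_err n <= 2 / n.+2%:R.
Proof.
elim: n => [|n /andP[e0 en]]; first by rewrite /= ler01 divff ?pnatr_eq0 // lexx.
have n2 : n.+3%:R = n.+2%:R + 1 :> R by rewrite -natr1.
have n1 : 2 <= n.+2%:R :> R by rewrite ler_nat.
move: e0 en => /=; move: (sqrt_err n) (n.+2%:R) n2 n1 => e a -> a2 e0.
rewrite !ler_pdivlMr; try lra; move=> ea.
have e1 : e <= 1 by nra.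
apply/andP; split; first by nra.
have h : e * a <= 2 := ea.
have a0 : 0 < a by lra.
rewrite -(ler_pM2r a0) -(ler_pM2r a0).
have -> : (e - e ^+ 2 / 2) * (a + 1) * a * a
  = (e * a - (e * a) ^+ 2 / (2 * a)) * (a * (a + 1)) by field; lra.
move: (e * a) h (mulr_ge0 e0 (ltW a0)) => s s2 s0.
have -> : (s - s ^+ 2 / (2 * a)) * (a * (a + 1)) = (s * a - s ^+ 2 / 2) * (a + 1).
  by field; lra.
have h1 : s * a - s ^+ 2 / 2 <= 2 * a - 2.
  have : 0 <= (2 - s) * (a - (s + 2) / 2) by rewrite mulr_ge0; lra.
  by rewrite expr2; lra.
have : (s * a - s ^+ 2 / 2) * (a + 1) <= (2 * a - 2) * (a + 1).
  by rewrite ler_wpM2r //; lra.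
have -> : 2 * a * a = (2 * a - 2) * (a + 1) + 2 by ring.
lra.
Qed.

Local Notation e := sqrt_err.

Lemma sqrt_err_ge0 n : 0 <= e n.
Proof. by have /andP[] := sqrt_err_bound n. Qed.

Lemma sqrt_err_le1 n : e n <= 1.
Proof. by elim: n => //= n; have := sqr_ge0 (e n); lra. Qed.

Lemma sqrt_err_small (d : R) : 0 < d -> exists N, forall n, (N <= n)%N -> e n < d.
Proof.
move=> d0; have [|N HN] := @invS_lt R (d / 2); first by rewrite divr_gt0.
exists N => n Nn; have /andP[_] := sqrt_err_bound n.
have := HN n.+1 (leq_trans Nn (leqnSn n)).
by move: (_%:R^-1) => a; lra.
Qed.

(** Identities between limits of the iteration are proved by estimating the
    difference of both sides for each n. *)
Lemma eq_sqrt_err (x y : V) (c : R) : (forall n, nrm (x - y) <= e n * c) -> x = y.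
Proof.
move=> h; apply/eqP; rewrite -subr_eq0; apply/eqP/nrm_le0.
apply/ler_addgt0Pr => d d0; rewrite add0r.
have c1 : 0 < `|c| + 1 by have := normr_ge0 c; lra.
have [|N /(_ _ (leqnn N)) HN] := @sqrt_err_small (d / (`|c| + 1)).
  by rewrite divr_gt0.
apply: le_trans (h N) _; rewrite -(divfK (lt0r_neq0 c1) d).
apply: (@le_trans _ _ (e N * (`|c| + 1))).
  by rewrite ler_wpM2l ?sqrt_err_ge0 //; have := ler_norm c; lra.
by rewrite ler_wpM2r ?(ltW HN) ?(ltW c1).
Qed.

Section Iteration.
Variable A : {linear V -> V}.
Hypothesis A_near1 : forall x, nrm (x - A x) <= nrm x.

(** Writing 1 - Z for the root of A, the equation (1 - Z)^2 = A is the fixed point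
    equation Z = (1 - A + Z^2) / 2, which is iterated from 0. *)
Fixpoint sqrt_iter (n : nat) (x : V) : V :=
  if n is n'.+1
  then (((2^-1 : R)%:C)%C) *: (x - A x + sqrt_iter n' (sqrt_iter n' x)) else 0.
Local Notation Z := sqrt_iter.

Lemma half_ge0 : 0 <= 2^-1 :> R. Proof. by rewrite invr_ge0. Qed.

Lemma sqrt_iter_linear n (c : R[i]) x y : Z n (c *: x + y) = c *: Z n x + Z n y.
Proof.
elim: n x y => [|n IH] x y /=; first by rewrite scaler0 addr0.
rewrite !IH linearP scalerA mulrC -scalerA -scalerDr; congr (_ *: _).
by rewrite opprD (addrACA (c *: x)) (addrACA (c *: x - c *: A x)) !scalerDr scalerN.
Qed.

Lemma sqrt_iterB n x y : Z n (x - y) = Z n x - Z n y.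
Proof. by rewrite addrC -scaleN1r sqrt_iter_linear scaleN1r addrC. Qed.

Lemma sqrt_iter_bound n x : nrm (Z n x) <= (1 - e n) * nrm x.
Proof.
elim: n x => [|n IH] x /=; first by rewrite nrm0 subrr mul0r.
rewrite nrmZr ?half_ge0 //.
have := nrmD (x - A x) (Z n (Z n x)); have := A_near1 x; have := IH (Z n x).
have e1 : 0 <= 1 - e n by rewrite subr_ge0 sqrt_err_le1.
have := ler_wpM2l e1 (IH x); rewrite expr2; lra.
Qed.

(** Z_{n+1}^2 - Z_n^2 = Z_{n+1} (Z_{n+1} - Z_n) + (Z_{n+1} - Z_n) Z_n, and the
    resulting recursion for the bound is exactly that of [sqrt_err]. *)
Lemma sqrt_iter_step n x : nrm (Z n.+1 x - Z n x) <= (e n - e n.+1) * nrm x.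
Proof.
elim: n x => [|n IH] x.
  rewrite /= !addr0 subr0 nrmZr ?half_ge0 // expr1n.
  by have := A_near1 x; lra.
have -> : Z n.+2 x - Z n.+1 x =
    ((2^-1)%:C)%C *: (Z n.+1 (Z n.+1 x - Z n x) + (Z n.+1 (Z n x) - Z n (Z n x))).
  rewrite sqrt_iterB addrA subrK [in LHS]/= -scalerBr; congr (_ *: _).
  by rewrite opprD addrACA subrr add0r.
rewrite nrmZr ?half_ge0 //.
have := nrmD (Z n.+1 (Z n.+1 x - Z n x)) (Z n.+1 (Z n x) - Z n (Z n x)).
have := IH (Z n x); have := sqrt_iter_bound n.+1 (Z n.+1 x - Z n x).
have e1 : 0 <= 1 - e n.+1 by rewrite subr_ge0 sqrt_err_le1.
have d0 : 0 <= e n - e n.+1 by rewrite /=; have := sqr_ge0 (e n); lra.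
have h1 := ler_wpM2l e1 (IH x).
have h2 := ler_wpM2l d0 (sqrt_iter_bound n x).
have -> : e n.+1 - e n.+2 = 2^-1 *
    ((1 - e n.+1) * (e n - e n.+1) + (e n - e n.+1) * (1 - e n)).
  by rewrite /=; field.
move: h1 h2; move: (e n.+1) (e n) {e1 d0 IH} => a b; rewrite !mulrDl -!mulrA.
lra.
Qed.

Lemma sqrt_iter_cauchy n m x : (n <= m)%N ->
  nrm (Z m x - Z n x) <= (e n - e m) * nrm x.
Proof.
elim: m => [|m IH]; first by rewrite leqn0 => /eqP ->; rewrite !subrr nrm0 mul0r.
rewrite leq_eqVlt => /predU1P[->|/IH {}IH]; first by rewrite !subrr nrm0 mul0r.
have := nrmD (Z m.+1 x - Z m x) (Z m x - Z n x); have := sqrt_iter_step m x.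
by rewrite addrA subrK; move: (Z m.+1 x) (e m.+1) => ? ?; lra.
Qed.

Lemma sqrt_iter_cvg x : exists l, forall n, nrm (l - Z n x) <= e n * nrm x.
Proof.
have [|l lZ] := @nsq_complete _ _ (fun n => Z n x).
  move=> d d0.
  have x1 : 0 < nrm x + 1 by have := nrm_ge0 x; lra.
  have [|N HN] := @sqrt_err_small (Num.sqrt d / (nrm x + 1)).
    by rewrite divr_gt0 // sqrtr_gt0.
  exists N => m n Nm Nn.
  wlog nm : m n Nm Nn / (n <= m)%N.
    by move=> h; have [/h|/ltnW/h] := leqP n m; [|rewrite nsqB]; apply.
  rewrite -nrm_sq -[ltRHS]sqr_sqrtr ?(ltW d0) //.
  rewrite ltr_pXn2r ?nnegrE ?nrm_ge0 ?sqrtr_ge0 //.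
  apply: le_lt_trans (sqrt_iter_cauchy x nm) _.
  have := HN n Nn; rewrite ltr_pdivlMr // mulrDr mulr1.
  have := sqrt_err_ge0 n; have := mulr_ge0 (sqrt_err_ge0 m) (nrm_ge0 x).
  by rewrite mulrBl; lra.
exists l => n; apply/ler_addgt0Pr => d d0.
have [|N /(_ (maxn N n) (leq_maxl _ _))] := lZ (d ^+ 2); first by rewrite exprn_gt0.
rewrite -nrm_sq ltr_pXn2r ?nnegrE ?nrm_ge0 ?(ltW d0) // nrmB.
have := sqrt_iter_cauchy x (leq_maxr N n).
have := nrmD (l - Z (maxn N n) x) (Z (maxn N n) x - Z n x).
rewrite addrA subrK mulrBl.
have := mulr_ge0 (sqrt_err_ge0 (maxn N n)) (nrm_ge0 x).
lra.
Qed.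

End Iteration.

(** The condition |x - A x| <= |x| plays the role of 0 <= A <= 2, and the root
    inherits it, so that roots of roots can be taken.  The root is a limit of
    polynomials in A, hence the commutation property. *)
Lemma bounded_sqrt (A : {linear V -> V}) :
  symmetric_map A -> (forall x, nrm (x - A x) <= nrm x) ->
  exists S : {linear V -> V}, [/\ symmetric_map S,
    forall x, nrm (x - S x) <= nrm x,
    forall x, S (S x) = A x &
    forall (B : {linear V -> V}) M, 0 <= M -> (forall x, nrm (B x) <= M * nrm x) ->
      (forall x, A (B x) = B (A x)) -> forall x, S (B x) = B (S x)].
Proof.
move=> A_sym A_near1.
pose Z := sqrt_iter A.
have /choice[L LZ] := sqrt_iter_cvg A_near1.
have {}LZ x n : nrm (L x - Z n x) <= e n * nrm x by exact: LZ.
have Zb n x : nrm (Z n x) <= (1 - e n) * nrm x by exact: sqrt_iter_bound.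
have LZ' n x : nrm (Z n x - L x) <= e n * nrm x by rewrite nrmB; exact: LZ.
have L_lin : linear L.
  move=> c x y; apply: (@eq_sqrt_err _ _
    (nrm (c *: x + y) + (complex.Re `|c| * nrm x + nrm y))) => n.
  have -> : L (c *: x + y) - (c *: L x + L y) = (L (c *: x + y) - Z n (c *: x + y)) +
      (c *: (Z n x - L x) + (Z n y - L y)).
    rewrite /Z sqrt_iter_linear scalerBr (addrACA (c *: _)) -opprD.
    by rewrite addrA subrK.
  apply: le_trans (nrmD _ _) _; rewrite mulrDr lerD //.
  apply: le_trans (nrmD _ _) _; rewrite mulrDr lerD //.
  rewrite nrmZ mulrCA ler_wpM2l //.
  by have := normr_ge0 c; rewrite lecE => /andP[].
have L_bound x : nrm (L x) <= nrm x.
  have := nrmD (L x - Z 0%N x) (Z 0%N x); rewrite subrK.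
  have := LZ x 0%N; have := Zb 0%N x; rewrite [e 0]/=; lra.
have L_eq x : L x = ((2^-1 : R)%:C)%C *: (x - A x + L (L x)).
  apply: (@eq_sqrt_err _ _ (2 * nrm x)) => n.
  have -> : L x - ((2^-1)%:C)%C *: (x - A x + L (L x)) =
      (L x - Z n.+1 x) +
      ((2^-1)%:C)%C *: (Z n (Z n x - L x) + (Z n (L x) - L (L x))).
    rewrite {2}/Z sqrt_iterB addrA subrK [Z n.+1 x]/= -/Z.
    rewrite -[RHS]addrA -!scalerN -scalerDr; congr (_ + _ *: _).
    by rewrite !opprD -!addrA addKr.
  have := nrmD (L x - Z n.+1 x)
    (((2^-1)%:C)%C *: (Z n (Z n x - L x) + (Z n (L x) - L (L x)))).
  rewrite nrmZr ?half_ge0 //.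
  have := nrmD (Z n (Z n x - L x)) (Z n (L x) - L (L x)).
  have := LZ x n.+1; have := LZ' n (L x); have := Zb n (Z n x - L x).
  have e0 := sqrt_err_ge0 n.
  have := ler_wpM2l e0 (L_bound x).
  have := mulr_ge0 e0 (nrm_ge0 (Z n x - L x)).
  have := LZ' n x.
  have : e n.+1 * nrm x <= e n * nrm x.
    by rewrite ler_wpM2r ?nrm_ge0 //=; have := sqr_ge0 (e n); lra.
  by move: (Z n.+1 x) (e n.+1) => ? ?; rewrite -/Z mulrBl; lra.
have ZA_comm (B : {linear V -> V}) n x : (forall x, A (B x) = B (A x)) ->
    Z n (B x) = B (Z n x).
  move=> AB; elim: n x => [|n IH] x; first by rewrite /Z /= linear0.
  rewrite /Z /= (linearZ_LR B) (linearD B) (linearB B) -AB.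
  by rewrite -!/(sqrt_iter A n) -/Z !IH.
have L_comm (B : {linear V -> V}) M : 0 <= M -> (forall x, nrm (B x) <= M * nrm x) ->
    (forall x, A (B x) = B (A x)) -> forall x, L (B x) = B (L x).
  move=> M0 BM AB x; apply: (@eq_sqrt_err _ _ (M * nrm x + M * nrm x)) => n.
  have -> : L (B x) - B (L x) = (L (B x) - Z n (B x)) + B (Z n x - L x).
    by rewrite linearB ZA_comm // addrA subrK.
  apply: le_trans (nrmD _ _) _; rewrite mulrDr lerD //.
    by apply: le_trans (LZ _ _) _; rewrite ler_wpM2l ?sqrt_err_ge0.
  by apply: le_trans (BM _) _; rewrite mulrCA ler_wpM2l.
have Z_sym n x y : inner (Z n x) y = inner x (Z n y).
  elim: n x y => [|n IH] x y; first by rewrite /Z /= inner0l inner0r.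
  rewrite /Z /= -/Z innerZl innerZrr !innerDl !innerDr.
  by rewrite innerNl innerNr A_sym !IH.
have L0 : L 0 = 0 by apply: nrm_le0; have := L_bound 0; rewrite nrm0.
have L_sym : symmetric_map L.
  suff L_rip x y : rip (L x) y = rip x (L y).
    move=> x y; apply: eq_complex_Re; first exact: L_rip.
    have iL : 'i%C *: L x = L ('i%C *: x).
      by have := L_lin 'i%C x 0; rewrite L0 !addr0.
    by rewrite -!innerZl iL; exact: L_rip.
  apply/eqP; rewrite -subr_eq0; apply/eqP/normr0_eq0/le_anti.
  rewrite normr_ge0 andbT; apply/ler_addgt0Pr => d d0; rewrite add0r.
  pose c := nrm x * nrm y; have c0 : 0 <= c by rewrite mulr_ge0 ?nrm_ge0.
  have [|N /(_ _ (leqnn N)) HN] := @sqrt_err_small (d / (2 * c + 1)).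
    by rewrite divr_gt0 //; lra.
  have -> : rip (L x) y - rip x (L y) =
      rip (L x - Z N x) y + rip x (Z N y - L y).
    rewrite !ripE (_ : rip (Z N x) y = rip x (Z N y)); first by ring.
    by rewrite /rip Z_sym.
  apply: le_trans (ler_normD _ _) _.
  have := rip_cauchy_schwarz (L x - Z N x) y.
  have := rip_cauchy_schwarz x (Z N y - L y).
  have := ler_wpM2r (nrm_ge0 y) (LZ x N); have := ler_wpM2l (nrm_ge0 x) (LZ' N y).
  have := HN; rewrite ltr_pdivlMr; last lra.
  have := sqrt_err_ge0 N; rewrite /c; lra.
have S_lin : linear (fun x => x - L x).
  move=> c x y /=; rewrite L_lin opprD (addrACA (c *: x)) scalerBr //.
pose S : {linear V -> V} :=
  HB.pack (fun x => x - L x) (GRing.isLinear.Build _ _ _ _ _ S_lin).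
exists S; split=> [x y|x|x|B M M0 BM AB x] /=.
- by rewrite innerDl innerDr innerNl innerNr L_sym.
- by rewrite subKr.
- have LB u v : L (u - v) = L u - L v.
    by rewrite addrC -scaleN1r L_lin scaleN1r addrC.
  have half2 w : ((2^-1 : R)%:C)%C *: w + ((2^-1)%:C)%C *: w = w.
    rewrite -scalerDl -rmorphD /= (_ : _ + _ = 1); last by field.
    by rewrite rmorph1 scale1r.
  have e2 : L x + L x = x - A x + L (L x) by rewrite -[RHS]half2 -!L_eq.
  have -> : x - L x - L (x - L x) = x - (L x + L x) + L (L x).
    by rewrite LB opprB opprD (addrC (L (L x))) !addrA.
  by rewrite e2 opprD [x + _]addrA subrK opprB addrC subrK.
- by rewrite (L_comm _ M) // linearB.
Qed.

End SquareRoot.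

Local Open Scope relation_scope.

(** * Adjoints and graphs *)
Section Relations.
Variable R : realType.
Implicit Types U V W : hilbertType R.

Lemma orth_closure2 U V (D : set (U * V)) a b :
  (forall p, D p -> inner a p.1 + inner b p.2 = 0) ->
  forall p, closure D p -> inner a p.1 + inner b p.2 = 0.
Proof.
move=> D0 p /closure_nsq2P cD.
suff Re0 a' b' : (forall q, D q -> inner a' q.1 + inner b' q.2 = 0) ->
    complex.Re (inner a' p.1 + inner b' p.2) = 0.
  apply: eq_complex_Re; first by rewrite Re0.
  rewrite mulr0 mulrDr -!innerZl Re0 // => q /D0 abq.
  by rewrite !innerZl -mulrDr abq mulr0.
move=> D0'; apply: (@quadratic_ge0 _ (nsq a' + nsq b')).
  by rewrite addr_ge0 ?nsq_ge0.
move=> t e e0; have [q /D0' /(congr1 (@complex.Re R))] := cD _ e0.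
have := nsq_ge0 ((t%:C)%C *: a' + (p.1 - q.1)).
have := nsq_ge0 ((t%:C)%C *: b' + (p.2 - q.2)).
rewrite !ReD -!/(rip _ _) /nsq !ripE (ripC a' p.1) (ripC a' q.1).
rewrite (ripC b' p.2) (ripC b' q.2) (ripC p.1 q.1) (ripC p.2 q.2).
move=> h1 h2 /eqP; rewrite addr_eq0 => /eqP h3; rewrite h3 in h2 *.
suff : 0 <= t ^+ 2 * (rip a' a' + rip b' b') by lra.
by rewrite mulr_ge0 ?sqr_ge0 // addr_ge0 ?nsq_ge0.
Qed.

Lemma orth_closure V (D : set V) a :
  (forall y, D y -> inner y a = 0) -> forall y, closure D y -> inner y a = 0.
Proof.
move=> D0 y /closure_nsqP cD.
have cD2 : closure [set (z, z) | z in D] (y, y).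
  apply/closure_nsq2P => e e0; have [|z Dz yz] := cD (e / 2).
    by rewrite divr_gt0.
  by exists (z, z); [exists z | rewrite /=; lra].
suff : inner a (y, y).1 + inner 0 (y, y).2 = 0.
  by rewrite /= inner0l addr0; exact: innerC0.
apply: orth_closure2 cD2 => _ [z Dz <-].
by rewrite /= inner0l addr0; apply/innerC0/D0.
Qed.

Lemma adjoint_linear U V (A : set (U * V)) : linear_relation (adjoint A).
Proof.
split=> [x y _|c p q Ap Aq x y Axy]; first by rewrite !inner0r.
by rewrite /= !innerDr !innerZr (Ap _ _ Axy) (Aq _ _ Axy).
Qed.

Lemma adjoint_closed U V (A : set (U * V)) : closed (adjoint A).
Proof.
move=> p cp x y Axy; apply/eqP; rewrite -subr_eq0 -innerNl; apply/eqP.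
apply: orth_closure2 cp => q Aq.
by rewrite (Aq _ _ Axy) innerNl subrr.
Qed.

Lemma adjoint_operator U V (A : set (U * V)) :
  dense (dom A) -> operator (adjoint A).
Proof.
move=> /dense_closureP dA; split=> [|y Ay]; first exact: adjoint_linear.
apply: nsq_eq0; rewrite /nsq /rip (orth_closure _ (dA y)) // => _ [[x z] Axz <-].
by have := Ay _ _ Axz; rewrite /= inner0r => <-.
Qed.

(** The case of functionals on V, seen as the second factor of V * V. *)
Lemma riesz V (G : set (V * R[i])) (c : R) :
  G (0, 0) ->
  (forall (a : R[i]) p q, G p -> G q -> G (a *: p.1 + q.1, a * p.2 + q.2)) ->
  (forall p, G p -> 2 * complex.Re p.2 <= nsq p.1 + c) ->
  exists v, [/\ closure [set p.1 | p in G] v,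
    forall p, G p -> inner p.1 v = p.2 & nsq v <= c].
Proof.
move=> G0 Glin Gc.
pose G' : set ((V * V) * R[i]) := [set p | p.1.1 = 0 /\ G (p.1.2, p.2)].
have [|a p q [p0 Gp] [q0 Gq]|p [p0 Gp]|v [cv Gv vc]] := @riesz_pair _ V V G' c.
- by split.
- by split; [rewrite /= p0 q0 scaler0 addr0 | exact: Glin Gp Gq].
- by have := Gc _ Gp; rewrite p0 nsq0 add0r.
exists v.2; split=> [|p Gp|].
- apply/closure_nsqP => e e0; have /closure_nsq2P/(_ _ e0) := cv.
  move=> [_ [p [_ Gp] <-]] ve; exists p.1.2; first by exists (p.1.2, p.2).
  by apply: le_lt_trans ve; rewrite lerDr nsq_ge0.
- have := Gv ((0, p.1), p.2) (conj erefl _); rewrite /= inner0l add0r; apply.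
  by case: p Gp.
- by apply: le_trans vc; rewrite lerDr nsq_ge0.
Qed.

(** The orthogonal decomposition U * V = A + A^perp for a closed A.  The
    complement of A is the adjoint of A with its coordinates swapped and one sign
    changed, which gives the signs in the conclusion. *)
Lemma graph_decomposition U V (A : set (U * V)) :
  linear_relation A -> closed A -> forall x y,
  exists a b k h, [/\ A (a, b), adjoint A (k, h), x = a - h & y = b + k].
Proof.
move=> [A0 Alin] cA x y.
pose f (p : U * V) := inner p.1 x + inner p.2 y.
have [|c p q [Ap fp] [Aq fq]|p [Ap fp]|v [cv fv _]] :=
    @riesz_pair _ U V [set p | A p.1 /\ p.2 = f p.1] (nsq x + nsq y).
- by split; rewrite // /f /= !inner0l addr0.
- split; first exact: Alin.
  by rewrite /= fp fq /f /= !innerDl !innerZl; ring.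
- rewrite fp /f ReD -!/(rip _ _).
  by have := rip_le2 p.1.1 x; have := rip_le2 p.1.2 y; lra.
have Av : A v.
  apply: cA; apply: closure_subset cv => _ [p [Ap _] <-] //.
exists v.1, v.2, (y - v.2), (v.1 - x); split.
- by case: v Av {cv fv}.
- move=> a b Aab; have /= := fv ((a, b), f (a, b)) (conj Aab erefl).
  rewrite /f /= !innerDr !innerNr => e.
  apply/eqP; rewrite -subr_eq0; apply/eqP.
  by rewrite -[RHS](subrr (inner a x + inner b y)) -{2}e; ring.
- by rewrite opprB addrC subrK.
- by rewrite addrC subrK.
Qed.

Lemma relationB U V (A : set (U * V)) p q :
  linear_relation A -> A p -> A q -> A (p - q).
Proof. by move=> [_ Al] Ap Aq; rewrite addrC -scaleN1r; exact: Al. Qed.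

(** Decompose a point of the double adjoint along A: its component orthogonal to A
    is both in the double adjoint and, up to a rotation, in the adjoint, so it is
    orthogonal to itself. *)
Lemma adjointK U V (A : set (U * V)) :
  linear_relation A -> closed A -> adjoint (adjoint A) = A.
Proof.
move=> Al cA; apply/seteqP; split=> [[x y] Axy|[x y] Axy k h Akh]; last first.
  by rewrite /= (innerC x h) -[inner x h](Akh _ _ Axy) -innerC.
have [a [b [k [h [Aab Akh ex ey]]]]] := graph_decomposition Al cA x y.
have := Axy _ _ Akh.
rewrite /= ex ey innerDr innerNr innerDr innerC [inner k b]innerC.
rewrite (Akh _ _ Aab) /= => /eqP; rewrite -subr_eq0 opprD addrACA subrr add0r.
rewrite -opprD oppr_eq0 !inner_nsq -rmorphD /= => /eqP /(congr1 (@complex.Re R)) /= e.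
have h0 : h = 0 by apply: nsq_le0; have := nsq_ge0 k; lra.
have k0 : k = 0 by apply: nsq_le0; have := nsq_ge0 h; lra.
by rewrite h0 k0 subr0 addr0.
Qed.

Lemma dense_orth V (D : set V) :
  D 0 -> (forall (c : R[i]) x y, D x -> D y -> D (c *: x + y)) ->
  (forall y, (forall d, D d -> inner d y = 0) -> y = 0) -> dense D.
Proof.
move=> D0 Dl Dorth; apply/dense_closureP => x.
have [|c p q [Ap fp] [Aq fq]|p [Ap fp]|v [cv fv _]] :=
    @riesz V [set p | D p.1 /\ p.2 = inner p.1 x] (nsq x).
- by split; rewrite //= inner0l.
- by split; [exact: Dl | rewrite /= fp fq innerDl innerZl].
- by rewrite fp -/(rip _ _) rip_le2.
have -> : x = v.
  apply/eqP; rewrite -subr_eq0; apply/eqP/Dorth => d Dd.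
  rewrite innerDr innerNr.
  by rewrite (fv (d, inner d x) (conj Dd erefl)) subrr.
by apply: closure_subset cv => _ [p [Dp _] <-].
Qed.

End Relations.

(** * Nonnegative selfadjoint operators and form domains *)
Section Operators.
Variable R : realType.
Implicit Types U V W : hilbertType R.

Lemma nonnegative_rip V (C : set (V * V)) x y :
  nonnegative C -> C (x, y) -> 0 <= rip y x.
Proof. by move=> C0 /C0; rewrite lecE => /andP[_]. Qed.

Lemma nsqD_nonneg V (C : set (V * V)) x y :
  nonnegative C -> C (x, y) -> nsq x + nsq y <= nsq (x + y).
Proof.
by move=> C0 /(nonnegative_rip C0); rewrite /nsq !ripE (ripC x y); lra.
Qed.

Lemma selfadjoint_sym V (C : set (V * V)) x y u w :
  selfadjoint C -> C (x, y) -> C (u, w) -> inner y u = inner x w.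
Proof. by move=> [_ _ aC] Cxy; rewrite -{1}aC; apply. Qed.

Lemma selfadjoint_closed V (C : set (V * V)) : selfadjoint C -> closed C.
Proof. by move=> [_ _ <-]; exact: adjoint_closed. Qed.

(** 1 + C is onto.  As |x| <= |x + C x|, the functional x + C x |-> <x, h> is
    bounded; its representative v satisfies <C x, v> = <x, h - v> for all x in
    dom C, that is, C^* v = h - v. *)
Lemma nonneg_selfadjoint_onto V (C : set (V * V)) h :
  nonneg_selfadjoint C -> exists x, C (x, h - x).
Proof.
move=> [C0 sC]; have [[Cl _] _ aC] := sC.
pose G : set (V * R[i]) :=
  [set p | exists x y, [/\ C (x, y), p.1 = x + y & p.2 = inner x h]].
have [|c p q [x [y [Cxy p1 p2]]] [u [w [Cuw q1 q2]]]|p|v [_ Gv _]] :=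
    @riesz R V G (nsq h).
- by exists 0, 0; rewrite /= addr0 inner0l; split=> //; case: Cl.
- exists (c *: x + u), (c *: y + w); split=> /=; first exact: (Cl.2 c (x, y) (u, w)).
    by rewrite p1 q1 scalerDr addrACA.
  by rewrite p2 q2 innerDl innerZl.
- move=> [x [y [Cxy -> ->]]]; rewrite -/(rip _ _).
  have := nsqD_nonneg C0 Cxy; have := nsq_ge0 y; have := rip_le2 x h; lra.
exists v; rewrite -aC => x y Cxy /=.
have /= := Gv (x + y, inner x h) (ex_intro _ x (ex_intro _ y (And3 Cxy erefl erefl))).
by rewrite innerDl innerDr innerNr => <-; rewrite addrAC subrr add0r.
Qed.

(** 1 + T^* T is onto: project (h, 0) onto the graph of T. *)
Lemma adjoint_comp_onto U V (T : set (U * V)) h :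
  linear_relation T -> closed T -> exists x, (adjoint T \; T) (x, h - x).
Proof.
move=> Tl cT.
have [a [b [k [g [Tab Tkg eh e0]]]]] := graph_decomposition Tl cT h 0.
exists a; exists b => //=.
have -> : b = - k by apply/eqP; rewrite -addr_eq0 e0.
have -> : h - a = - g by rewrite eh addrC addKr.
by move=> x y Txy; rewrite /= !innerNr (Tkg _ _ Txy).
Qed.

(** If 1 + C is onto, a symmetric C has no proper symmetric extension: for
    (x, h) in C^*, solve (1 + C) u = x + h; then d = x - u satisfies C^* d = - d,
    so d is orthogonal to ran (1 + C). *)
Lemma symmetric_onto_selfadjoint V (C : set (V * V)) :
  operator C -> nonnegative C -> C `<=` adjoint C ->
  (forall h, exists x, C (x, h - x)) -> nonneg_selfadjoint C.
Proof.
move=> [Cl Cop] C0 Csym Conto; split=> //; split=> //.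
- apply: dense_orth.
  + by exists (0, 0) => //; case: Cl.
  + by move=> c x y [p Cp <-] [q Cq <-]; exists (c *: p + q) => //; exact: Cl.2.
  move=> y yC; have [x Cx] := Conto y.
  have := yC x (ex_intro2 _ _ _ Cx erefl).
  have := nonnegative_rip C0 Cx; move: Cx.
  set w := y - x => Cxw; have -> : y = x + w by rewrite addrC subrK.
  move=> w0 /(congr1 (@complex.Re R)); rewrite -/(rip _ _) ripDr (ripC w x).
  move: w0; rewrite -/(nsq _) => w0 /= xw; have := nsq_ge0 x => x0.
  have x00 : x = 0 by apply: nsq_le0; lra.
  by move: Cxw; rewrite x00 => /Cop ->; rewrite addr0.
- apply/seteqP; split=> // -[x h] Axh.
  have [u Cu] := Conto (x + h).
  suff xu : x - u = 0.
    by have /eqP := xu; rewrite subr_eq0 => /eqP e; move: Cu; rewrite -e addrC addKr.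
  have [a Ca] := Conto (x - u).
  have := relationB (adjoint_linear C) Axh (Csym _ Cu) _ _ Ca => /=.
  have -> : h - (x + h - u) = - (x - u) by rewrite addrAC opprD addrCA subrr addr0.
  move: (x - u) Ca => d _ e; apply: nsq_eq0; rewrite /nsq /rip.
  by rewrite -[X in inner X _](subrK a) innerDl e innerNr addNr.
Qed.

Lemma comp_linear U V W (A : set (U * V)) (B : set (V * W)) :
  linear_relation A -> linear_relation B -> linear_relation (B \; A).
Proof.
move=> [A0 Al] [B0 Bl]; split=> [|c p q [y Ay By] [z Az Bz]]; first by exists 0.
by exists (c *: y + z); [exact: Al Ay Az | exact: Bl By Bz].
Qed.

(** Von Neumann's theorem on T^* T. *)
Lemma adjoint_comp_nonneg_selfadjoint U V (T : set (U * V)) :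
  closed_densely_defined T -> nonneg_selfadjoint (adjoint T \; T).
Proof.
move=> [[Tl Top] cT dT]; have [aTl aTop] := adjoint_operator dT.
apply: symmetric_onto_selfadjoint.
- split; first exact: comp_linear.
  by move=> y [u /Top /= ->]; exact: aTop.
- move=> x y [u /= Txu Tuy]; apply: innerC_ge0.
  by rewrite -(Tuy _ _ Txu) inner_norm exprn_ge0.
- move=> [x y] [u /= Txu Tuy] a b [v /= Tav Tvb] /=.
  by rewrite innerC -(Tvb _ _ Txu) -innerC (Tuy _ _ Tav).
- by move=> h; exact: adjoint_comp_onto.
Qed.

(** Riesz representation of y |-> <y, h> composed with N. *)
Lemma contraction_adjoint U V (N : set (U * V)) h :
  linear_relation N -> (forall x y, N (x, y) -> nsq y <= nsq x) ->
  exists2 k, adjoint N (h, k) & nsq k <= nsq h.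
Proof.
move=> [N0 Nl] Nc.
have [|c p q [y1 [Ny1 p1]] [y2 [Ny2 p2]]|p [y [Ny ->]]|v [_ Gv vh]] :=
    @riesz R U [set p | exists y, N (p.1, y) /\ p.2 = inner y h] (nsq h).
- by exists 0; split=> //=; rewrite inner0l.
- exists (c *: y1 + y2); split; first exact: (Nl c (p.1, y1) (q.1, y2)).
  by rewrite /= p1 p2 innerDl innerZl.
- by have := Nc _ _ Ny; have := rip_le2 y h; rewrite -/(rip _ _); lra.
exists v => // x y Nxy.
by rewrite [RHS](Gv (x, inner y h)) //; exists y.
Qed.

(** The hypothesis says that x is a bounded functional T y |-> <T^* T y, x> on
    T (dom T^* T); let v represent it, so that v is in the closure of ran T.
    Subtracting from (x, v) its projection onto the graph of T leaves (- h, k) with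
    (k, h) in T^*.  Testing against T^* T gives <y + T^* T y, h> = 0 for all y,
    so h = 0 because 1 + T^* T is onto; then T^* k = 0, and k = 0 because k is
    orthogonal to ran T while v = T x + k is in its closure. *)
Lemma form_domain U V (T : set (U * V)) x (c : R) :
  linear_relation T -> closed T ->
  (forall y w, (adjoint T \; T) (y, w) -> 2 * rip w x <= rip w y + c) ->
  exists2 v, T (x, v) & nsq v <= c.
Proof.
move=> Tl cT hx; have [aT0 aTl] := adjoint_linear T.
pose G : set (V * R[i]) := [set p | exists y w,
  [/\ T (y, p.1), adjoint T (p.1, w) & p.2 = inner w x]].
have [|a p q [y [w [Ty Tw pE]]] [z [s [Tz Ts qE]]]|p [y [w [Ty Tw ->]]]|v [cv Gv vc]] :=
    @riesz R V G c.
- by exists 0, 0; split=> //; [case: Tl | rewrite inner0l].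
- exists (a *: y + z), (a *: w + s); split => /=.
  + exact: (Tl.2 a (y, p.1) (z, q.1)).
  + exact: (aTl a (p.1, w) (q.1, s)).
  + by rewrite pE qE innerDl innerZl.
- rewrite (_ : nsq p.1 = rip w y); first by apply: hx; exists p.1.
  by rewrite [RHS]ripC /rip -(Tw _ _ Ty).
have [a [b [k [h [Tab Tkh ex ev]]]]] := graph_decomposition Tl cT x v.
have h0 : h = 0.
  have [y [u /= Tyu Tuw]] := adjoint_comp_onto h Tl cT.
  have := Gv (u, _) (ex_intro _ y (ex_intro _ _ (And3 Tyu Tuw erefl))).
  rewrite /= ev ex innerDr [RHS]innerDr innerNr [inner u b]innerC.
  rewrite (Tuw _ _ Tab) -innerC => /addrI.
  rewrite (Tkh _ _ Tyu) /= => e; apply: nsq_eq0; rewrite /nsq /rip.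
  by rewrite -[X in inner X _](subrK y) innerDl e addrN.
have k0 : k = 0.
  rewrite h0 in Tkh; apply: nsq_eq0; rewrite /nsq /rip.
  have vk : inner v k = 0.
    apply: orth_closure cv => _ [p [y [w [Ty _ _]]] <-].
    by rewrite (Tkh _ _ Ty) inner0r.
  have := vk; rewrite ev innerDl (Tkh _ _ Tab) inner0r add0r.
  by move=> ->.
by exists v => //; rewrite ex ev h0 k0 subr0 addr0.
Qed.

End Operators.

(** * Square roots of unbounded operators *)
Section SqrtExists.
Variables (R : realType) (V : hilbertType R).

(** Expanding |x - A x|^2 <= |x|^2 gives 2 <A x, x> >= |A x|^2. *)
Lemma symmetric_near1_nonneg (A : V -> V) x :
  symmetric_map A -> (forall y, nrm (y - A y) <= nrm y) -> 0 <= inner (A x) x.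
Proof.
move=> A_sym /(_ x); rewrite -(@ler_pXn2r _ 2) ?nnegrE ?nrm_ge0 // !nrm_sq => h.
have : 0 <= rip (A x) x.
  have := nsq_ge0 (A x); move: h.
  by rewrite /nsq !ripE (ripC x (A x)) (ripC (A x) x); lra.
have := innerC (A x) x; rewrite -A_sym /rip.
case: (inner (A x) x) => u v [] e u0; rewrite lecE /= u0 andbT.
by apply/eqP; lra.
Qed.

(** J = (1 + C)^{-1}; both J and 1 - J are contractions because
    |x + C x|^2 >= |x|^2 + |C x|^2 for nonnegative C. *)
Lemma resolvent (C : set (V * V)) : nonneg_selfadjoint C ->
  exists J : {linear V -> V}, [/\ symmetric_map J,
    forall h, C (J h, h - J h), forall x y, C (x, y) -> J (x + y) = x,
    forall h, nrm (J h) <= nrm h & forall h, nrm (h - J h) <= nrm h].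
Proof.
move=> nC; have [C0 sC] := nC; have [[Cl Cop] _ _] := sC.
have /choice[J CJ] := fun h => nonneg_selfadjoint_onto h nC.
have uniq x y : C (x, y) -> J (x + y) = x.
  move=> Cxy; have := relationB Cl (CJ (x + y)) Cxy => /= /(nsqD_nonneg C0).
  set d := J (x + y) - x; rewrite (_ : d + _ = 0) ?nsq0; last first.
    by rewrite (addrAC (x + y)) addrK /d addrA subrK subrr.
  move=> h; apply/eqP; rewrite -subr_eq0; apply/eqP/nsq_le0.
  by apply: le_trans h; rewrite lerDl nsq_ge0.
have J_lin : linear J.
  move=> c h k; have := Cl.2 c _ _ (CJ h) (CJ k).
  rewrite [X in C X -> _](_ : _ = (c *: J h + J k, c *: h + k - (c *: J h + J k))).
    by move=> /uniq; rewrite [X in J X]addrC subrK.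
  by congr (_, _); rewrite /= scalerBr opprD (addrACA (c *: h)).
pose JL : {linear V -> V} := HB.pack J (GRing.isLinear.Build _ _ _ _ _ J_lin).
have bound h : nsq (J h) + nsq (h - J h) <= nsq h.
  by have := nsqD_nonneg C0 (CJ h); rewrite (addrC (J h) (h - J h)) subrK.
exists JL; split=> //=.
- move=> h k; rewrite -[k in LHS](subrK (J k)) -[h in RHS](subrK (J h)).
  by rewrite innerDr innerDl (selfadjoint_sym sC (CJ h) (CJ k)).
- move=> h; rewrite -(@ler_pXn2r _ 2) ?nnegrE ?nrm_ge0 // !nrm_sq.
  by apply: le_trans (bound h); rewrite lerDl nsq_ge0.
- move=> h; rewrite -(@ler_pXn2r _ 2) ?nnegrE ?nrm_ge0 // !nrm_sq.
  by apply: le_trans (bound h); rewrite lerDr nsq_ge0.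
Qed.

(** With J = (1 + C)^{-1} and K = 1 - J, formally C = K J^{-1}, so its root is
    P Q^{-1} with P = K^{1/2} and Q = J^{1/2}.  As a relation this is the set of
    pairs (Q u, P u), and no inverse is needed: P and Q commute and
    Q^2 + P^2 = 1, so P y = Q z implies (y, z) = (Q u, P u) with u = Q y + P z.
    This implication is [key]; it yields selfadjointness and the square. *)
Lemma sqrt_exists (C : set (V * V)) : nonneg_selfadjoint C ->
  exists S, nonneg_selfadjoint S /\ S \; S = C.
Proof.
move=> nC; have [C0 sC] := nC; have [[Cl Cop] _ _] := sC.
have [J [J_sym CJ JC Jb J1]] := resolvent nC.
have K_lin : linear (fun h => h - J h).
  by move=> c h k /=; rewrite linearP opprD (addrACA (c *: h)) scalerBr.
pose K : {linear V -> V} :=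
  HB.pack (fun h => h - J h) (GRing.isLinear.Build _ _ _ _ _ K_lin).
have K_sym : symmetric_map K.
  by move=> x y; rewrite /= innerDl innerDr innerNl innerNr J_sym.
have [Q [Q_sym Q1 QQ Q_comm]] := bounded_sqrt J_sym J1.
have K1 h : nrm (h - K h) <= nrm h by rewrite /= subKr.
have [P [P_sym P1 PP P_comm]] := bounded_sqrt K_sym K1.
have [Q' [Q'_sym Q'1 Q'Q' Q'_comm]] := bounded_sqrt Q_sym Q1.
have sqrt_bound (A : {linear V -> V}) : (forall x, nrm (x - A x) <= nrm x) ->
    forall x, nrm (A x) <= 2 * nrm x.
  move=> A1 x; have := nrmD (x - (x - A x)) 0; rewrite addr0 subKr.
  by have := nrmD x (- (x - A x)); rewrite subKr nrmN; have := A1 x; lra.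
have two0 : 0 <= 2 :> R by [].
have QK x : Q (K x) = K (Q x).
  have Kb z : nrm (K z) <= 1 * nrm z by rewrite mul1r J1.
  have JK z : J (K z) = K (J z) by rewrite /= linearB.
  exact: Q_comm ler01 Kb JK x.
have PQ x : P (Q x) = Q (P x).
  by apply: (P_comm Q 2 two0 (sqrt_bound _ Q1)) => z; rewrite QK.
have Q'P x : Q' (P x) = P (Q' x).
  exact: (Q'_comm P 2 two0 (sqrt_bound _ P1)).
have QQPP x : Q (Q x) + P (P x) = x by rewrite QQ PP /= addrC subrK.
have Q0 u : Q u = 0 -> u = 0.
  move=> Qu; apply: Cop; have := CJ u.
  by rewrite -QQ Qu linear0 subr0.
have key y z : P y = Q z -> Q (Q y + P z) = y /\ P (Q y + P z) = z.
  move=> e; split; first by rewrite linearD -PQ -e QQPP.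
  by rewrite linearD PQ e QQPP.
pose S : set (V * V) := range (fun u => (Q u, P u)).
have SE u : S (Q u, P u) by exists u.
exists S; split; last first.
  apply/seteqP; split=> [[x z] [y [u _ [<- e]] [v _ [f <-]]]|[x y] Cxy] /=.
    have [e1 e2] := key u v (etrans e (esym f)).
    rewrite -[X in C (Q X, _)]e1 -[X in C (_, P X)]e2 QQ PP; exact: CJ.
  exists (Q (P (x + y))) => /=.
    by exists (Q (x + y)); rewrite // QQ JC // PQ.
  by exists (P (x + y)); rewrite // PP /= JC // addrAC subrr add0r.
split.
  (* <P u, Q u> = <P v, v> with v = Q^{1/2} u, as Q^{1/2} commutes with P. *)
  move=> _ _ [u _ [<- <-]]; rewrite -Q'Q' -Q'_sym Q'P.
  exact: symmetric_near1_nonneg.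
split.
- split; first split.
  + by exists 0; rewrite // !linear0.
  + by move=> c _ _ [u _ <-] [v _ <-]; exists (c *: u + v); rewrite // !linearP.
  + by move=> _ [u _ [/Q0 -> <-]]; rewrite linear0.
- apply: dense_orth.
  + by exists (0, 0) => //; exists 0; rewrite // !linear0.
  + move=> c _ _ [_ [u _ <-] <-] [_ [v _ <-] <-].
    by exists (Q (c *: u + v), P (c *: u + v)) => //; rewrite /= linearP.
  + move=> y yQ; apply: Q0; apply: nsq_eq0; rewrite /nsq /rip.
    by rewrite -Q_sym yQ //; exists (Q (Q y), P (Q y)).
- apply/seteqP; split=> [[y z] Syz|_ [u _ <-] _ _ [v _ [<- <-]]] /=; last first.
    by rewrite Q_sym -PQ -P_sym.
  have e : P y = Q z.
    apply/eqP; rewrite -subr_eq0; apply/eqP/nsq_eq0; rewrite /nsq /rip.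
    rewrite innerDr innerNr -P_sym -Q_sym (Syz _ _ (SE _)) /=.
    by rewrite subrr.
  by have [e1 e2] := key _ _ e; exists (Q y + P z); rewrite ?e1 ?e2.
Qed.

Lemma sqrt_opP (C : set (V * V)) : nonneg_selfadjoint C ->
  nonneg_selfadjoint (sqrt_op C) /\ sqrt_op C \; sqrt_op C = C.
Proof.
by move=> /sqrt_exists CS; exact: (xgetPex set0 CS).
Qed.

End SqrtExists.

(** * The order of selfadjoint operators *)
Section Forms.
Variable R : realType.
Implicit Types U V W : hilbertType R.

(** The converse of [form_domain]: <w, x> = <T y, T x> and <w, y> = |T y|^2. *)
Lemma form_bound U V (T : set (U * V)) x v y w :
  T (x, v) -> (adjoint T \; T) (y, w) -> 2 * rip w x <= rip w y + nsq v.
Proof.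
move=> Txv [u /= Tyu Tuw].
have -> : rip w x = rip u v by rewrite ripC /rip -(Tuw _ _ Txv) /= -/(rip _ _) ripC.
have -> : rip w y = nsq u by rewrite ripC /rip -(Tuw _ _ Tyu).
exact: rip_le2.
Qed.

(** [form_domain] for the root S of C, for which S^* S = C. *)
Lemma sqrt_op_domain V (C : set (V * V)) x (c : R) : nonneg_selfadjoint C ->
  (forall y w, C (y, w) -> 2 * rip w x <= rip w y + c) ->
  exists2 v, sqrt_op C (x, v) & nsq v <= c.
Proof.
move=> /sqrt_opP[[S0 sS] SS] hx; have [[Sl _] _ aS] := sS.
apply: form_domain => //; first exact: selfadjoint_closed.
by rewrite aS SS.
Qed.

Lemma sqrt_op_bound V (C : set (V * V)) x v y w : nonneg_selfadjoint C ->
  sqrt_op C (x, v) -> C (y, w) -> 2 * rip w x <= rip w y + nsq v.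
Proof.
move=> /sqrt_opP[[S0 [_ _ aS]] SS] Sxv Cyw.
by apply: form_bound Sxv _; rewrite aS SS.
Qed.

Lemma sqrt_op_functional V (C : set (V * V)) x v w : nonneg_selfadjoint C ->
  sqrt_op C (x, v) -> sqrt_op C (x, w) -> v = w.
Proof.
move=> /sqrt_opP[[_ [[Sl Sop] _ _]] _] Sv Sw.
apply/eqP; rewrite -subr_eq0; apply/eqP/Sop.
by rewrite -(subrr x); exact: relationB Sl Sv Sw.
Qed.

(** Membership in dom D^{1/2} and the norm bound are stated together, which is the
    form that [sqrt_op_domain] delivers. *)
Lemma op_geP V (C D : set (V * V)) :
  nonneg_selfadjoint C -> nonneg_selfadjoint D ->
  op_ge C D <-> forall x v, sqrt_op C (x, v) ->
    exists2 z, sqrt_op D (x, z) & nsq z <= nsq v.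
Proof.
move=> nC nD; split=> [[_ _ sub le] x v Sxv|h].
  have [[a z] Saz /= ax] := sub x (ex_intro2 _ _ _ Sxv erefl).
  have Sz : sqrt_op D (x, z) by rewrite -ax.
  exists z => //.
  by rewrite -le_norm_nsq; exact: le Sxv Sz.
split=> //.
  move=> _ [[x v] Sxv <-] /=; have [z Sz _] := h _ _ Sxv.
  by exists (x, z).
move=> x y z Sy Sz; have [z' Sz' zy] := h _ _ Sy.
by rewrite (sqrt_op_functional nD Sz Sz') le_norm_nsq.
Qed.

Lemma zero_op_nonneg_selfadjoint V : nonneg_selfadjoint (@zero_op R V V).
Proof.
apply: symmetric_onto_selfadjoint.
- split=> //; split=> // c p q /= p0 q0.
  by rewrite /zero_op /= p0 q0 scaler0 addr0.
- by move=> x y; rewrite /zero_op /= => ->; rewrite inner0l.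
- by move=> [x y]; rewrite /zero_op /= => -> a b /= ->; rewrite inner0l inner0r.
- by move=> h; exists h; rewrite /zero_op /= subrr.
Qed.

Lemma op_ge_zero V (C : set (V * V)) : nonneg_selfadjoint C -> op_ge C zero_op.
Proof.
move=> nC; apply/op_geP => //; first exact: zero_op_nonneg_selfadjoint.
move=> x v _; apply: sqrt_op_domain; first exact: zero_op_nonneg_selfadjoint.
by move=> y w; rewrite /zero_op /= => ->; rewrite !rip0l mulr0 add0r nsq_ge0.
Qed.

Lemma scale_opP U V (c : R) (A : set (U * V)) x y : 0 < c ->
  scale_op (c%:C)%C A (x, y) <-> A (x, ((c^-1)%:C)%C *: y).
Proof.
move=> c0; have cK : (c%:C)%C * ((c^-1)%:C)%C = 1 :> R[i].
  by rewrite -rmorphM /= divff ?gt_eqF // rmorph1.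
split=> [[[a b] Aab [<- <-]]|Axy]; first by rewrite scalerA mulrC cK scale1r.
by exists (x, ((c^-1)%:C)%C *: y); rewrite //= scalerA cK scale1r.
Qed.

Lemma scale_op_linear U V (c : R[i]) (A : set (U * V)) :
  linear_relation A -> linear_relation (scale_op c A).
Proof.
move=> [A0 Al]; split; first by exists (0, 0); rewrite //= scaler0.
move=> a _ _ [p Ap <-] [q Aq <-]; exists (a *: p + q); first exact: Al.
by rewrite [RHS]surjective_pairing /= scalerDr !scalerA mulrC.
Qed.

Lemma scale_op_nonneg_selfadjoint V (c : R) (A : set (V * V)) : 0 < c ->
  nonneg_selfadjoint A -> nonneg_selfadjoint (scale_op (c%:C)%C A).
Proof.
move=> c0 [A0 [[Al Aop] dA aA]]; split; last split.
- move=> _ _ [[x y] Axy [<- <-]]; rewrite innerZl mulr_ge0 ?ler0c ?(ltW c0) //.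
  exact: A0.
- split; first exact: scale_op_linear.
  move=> _ [[x y] Axy [/= x0 <-]]; rewrite (Aop y) ?scaler0 //.
  by rewrite -x0.
- rewrite (_ : dom _ = dom A) //; apply/seteqP; split=> x.
    by move=> [_ [[a b] Aab <-] <-]; exists (a, b).
  by move=> [[a b] Aab <-]; exists (a, (c%:C)%C *: b) => //; exists (a, b).
- apply/seteqP; split=> [[k h] Akh|[k h]].
    apply/scale_opP => //; rewrite -aA => x y Axy /=.
    have := Akh x ((c%:C)%C *: y) (ex_intro2 _ _ _ Axy erefl).
    rewrite /= innerZl innerZrr => <-.
    by rewrite mulrA -rmorphM /= mulVf ?gt_eqF // rmorph1 mul1r.
  move=> /scale_opP - /(_ c0); rewrite -{1}aA => Akh x y /scale_opP - /(_ c0) Axy.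
  have /= := Akh _ _ Axy; rewrite innerZl innerZrr; apply: mulfI.
  by rewrite (fmorph_eq0 (real_complex R)) invr_eq0 gt_eqF.
Qed.

End Forms.

(** * Bounded operators from contractions *)
Section Extension.
Variable R : realType.
Implicit Types U V W : hilbertType R.

Lemma dense_setT V (D : set V) : D = [set: V] -> dense D.
Proof. by move=> ->; apply/dense_closureP => x; exact: subset_closure. Qed.

Lemma operator_functional U V (A : set (U * V)) x y z :
  operator A -> A (x, y) -> A (x, z) -> y = z.
Proof.
move=> [Al Aop] Ay Az; apply/eqP; rewrite -subr_eq0; apply/eqP/Aop.
by rewrite -(subrr x); exact: relationB Al Ay Az.
Qed.

(** An everywhere defined relation has no proper extension to an operator. *)
Lemma operator_sub U V (A : set (U * V)) :
  dom A = [set: U] -> forall B, operator B -> A `<=` B -> B `<=` A.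
Proof.
move=> dA B Bop AB [x y] Bxy.
have [[a z] Aaz /= ax] : dom A x by rewrite dA.
rewrite ax in Aaz; by rewrite (operator_functional Bop Bxy (AB _ Aaz)).
Qed.

(** The double adjoint of a densely defined contraction G is its continuous
    extension to the whole space, so the composite is the bounded operator whose
    form is <G x, G y>. *)
Lemma contraction_square U V (G : set (U * V)) :
  linear_relation G -> (forall x y, G (x, y) -> nsq y <= nsq x) ->
  closure (dom G) = [set: U] ->
  [/\ Bplus (adjoint G \; adjoint (adjoint G)), operator (adjoint (adjoint G)) &
      G `<=` adjoint (adjoint G)].
Proof.
move=> Gl Gc cG.
have dG : dense (dom G) by apply/dense_closureP => x; rewrite cG.
have aop := adjoint_operator dG.
have acon h : exists2 k, adjoint G (h, k) & nsq k <= nsq h.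
  exact: contraction_adjoint.
have acon' h k : adjoint G (h, k) -> nsq k <= nsq h.
  by have [l hl lh] := acon h; move=> /(operator_functional aop hl) <-.
have daG : dom (adjoint G) = [set: V].
  by apply/seteqP; split=> // h _; have [k hk _] := acon h; exists (h, k).
have aaop := adjoint_operator (dense_setT daG).
have aacon k : exists2 h, adjoint (adjoint G) (k, h) & nsq h <= nsq k.
  by apply: contraction_adjoint => //; case: aop.
split=> //; last first.
  move=> [x y] Gxy h k hk; rewrite /= (innerC x k) -[inner x k](hk _ _ Gxy).
  by rewrite -innerC.
set X := _ \; _.
have Xex k : exists2 l, X (k, l) & nsq l <= nsq k.
  have [h kh hk] := aacon k; have [l hl lh] := acon h.
  by exists l; [exists h | exact: le_trans hk].
have dX : dom X = [set: U].
  by apply/seteqP; split=> // k _; have [l kl _] := Xex k; exists (k, l).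
have Xl : linear_relation X by apply: comp_linear; [case: aaop | case: aop].
have Xop : operator X.
  split=> // y [h /= h1 h2]; case: aaop aop => _ aa0 [_ a0].
  by apply: a0; rewrite -(aa0 _ h1).
have Xsym : X `<=` adjoint X.
  move=> [k l] [h /= kh hl] x y [h' /= xh' h'y] /=.
  by rewrite (kh _ _ h'y) /= innerC -(xh' _ _ hl) -innerC.
split=> //.
  exists 1 => x y Xxy; rewrite rmorph1 mul1r le_norm_nsq.
  by have [l xl lx] := Xex x; rewrite (operator_functional Xop Xxy xl).
split; last first.
  split=> //; first exact: dense_setT.
  apply/seteqP; split=> //; apply: operator_sub => //.
  by apply: adjoint_operator; exact: dense_setT.
move=> k l [h /= kh hl]; rewrite (kh _ _ hl) inner_norm.
by rewrite exprn_ge0.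
Qed.

Lemma scale_op_Bplus V (c : R) (A : set (V * V)) : 0 < c ->
  Bplus A -> Bplus (scale_op (c%:C)%C A).
Proof.
move=> c0 [dA [M bA] nA]; split; last exact: scale_op_nonneg_selfadjoint.
  apply/seteqP; split=> // x _.
  have [[a b] Aab ax] : dom A x by rewrite dA.
  by exists (a, (c%:C)%C *: b) => //; exists (a, b).
exists (c * M) => _ _ [[x y] Axy [<- <-]] /=.
rewrite normrZ rmorphM /= -mulrA ger0_norm ?ler0c ?(ltW c0) //.
by rewrite ler_wpM2l ?ler0c ?(ltW c0) //; exact: bA.
Qed.

End Extension.

(** * The two implications *)
Section Main.
Variables (R : realType) (H K : hilbertType R) (T B : set (H * K)).
Hypothesis T_cdd : closed_densely_defined T.
Hypothesis B_cdd : closed_densely_defined B.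
Hypothesis A_sa : selfadjoint (adjoint B \; T).
Let A := adjoint B \; T.

(** For X = Y^{-1}, (x, X T x) is in B = B^{**} because T^* (X k) = B^* k for all k
    in dom B^*.  So the form of A at (x, x') is <X T x, T x'>; positivity of X at
    T x - T x' compares it with the values on the diagonal, and
    2 <X y, y> <= |X y|^2 + |y|^2 <= (M^2 + 1) |y|^2, which explains the choice
    of eta. *)
Lemma factor_dominates (Y : set (K * K)) :
  Bplus (Y^-1) -> adjoint T = adjoint B \; Y ->
  exists2 eta : R, 0 < eta &
    op_ge (adjoint T \; T) (scale_op (eta%:C)%C A) /\
    nonneg_selfadjoint (scale_op (eta%:C)%C A).
Proof.
move=> [dX [M bX] [X0 sX]] aT.
have [[Tl Top] cT dT] := T_cdd; have [[Bl Bop] cB dB] := B_cdd.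
have Xex k : exists l, Y (l, k).
  have [[a l] Yla /= <-] : dom (Y^-1) k by rewrite dX.
  by exists l.
have Xsym k l x y : Y (l, k) -> Y (y, x) -> inner l x = inner k y.
  by move=> kl xy; apply: (selfadjoint_sym sX).
have TB x y m : T (x, y) -> Y (m, y) -> B (x, m).
  move=> Txy my; rewrite -(adjointK Bl cB) => l h lh /=.
  have [p pl] := Xex l.
  have : adjoint T (p, h) by rewrite aT; exists l.
  move=> /(_ _ _ Txy) /=; rewrite -(Xsym _ _ _ _ my pl) => e.
  by rewrite innerC -e -innerC.
have nA : nonneg_selfadjoint A.
  split=> // x h [y /= Txy yh]; apply: innerC_ge0.
  have [m my] := Xex y.
  by rewrite -(yh _ _ (TB _ _ _ Txy my)); exact: X0 my.
have M1 : 0 < M ^+ 2 + 1 by have := sqr_ge0 M; lra.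
exists (M ^+ 2 + 1)^-1%R; first by rewrite invr_gt0.
set eta := (_ + 1)^-1%R; have eta0 : 0 < eta by rewrite invr_gt0.
have nD := scale_op_nonneg_selfadjoint eta0 nA.
have nC := adjoint_comp_nonneg_selfadjoint T_cdd.
split=> //; apply/op_geP => // x v Cxv.
have [y Txy yv] : exists2 y, T (x, y) & nsq y <= nsq v.
  by apply: form_domain => // a w; exact: sqrt_op_bound.
apply: sqrt_op_domain => // _ _ [[x' h'] [u' /= Tu' uh'] [<- <-]] /=.
have [m my] := Xex y; have [m' mu'] := Xex u'.
have -> : rip (((eta)%:C)%C *: h') x = eta * rip m u'.
  by rewrite ripZl /rip (uh' _ _ (TB _ _ _ Txy my)) -/(rip _ _) ripC.
have -> : rip (((eta)%:C)%C *: h') x' = eta * rip m' u'.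
  by rewrite ripZl /rip (uh' _ _ (TB _ _ _ Tu' mu')) -/(rip _ _) ripC.
have pos : 0 <= rip (m' - m) (u' - y).
  have [[Xl _] _ _] := sX; apply: (nonnegative_rip X0).
  exact: (relationB Xl (mu' : (Y^-1) (u', m')) (my : (Y^-1) (y, m))).
have mM : nsq m <= M ^+ 2 * nsq y.
  have := bX y m my; rewrite !norm_nrm -rmorphM lecR -!nrm_sq -exprMn => h.
  have mp := nrm_ge0 m.
  by rewrite ler_pXn2r ?nnegrE //; apply: le_trans h.
have my2 := rip_le2 m y.
have e1 : rip m' y = rip m u'.
  by rewrite [RHS]ripC /rip (Xsym _ _ _ _ mu' my).
have key : eta * rip m y <= nsq v.
  apply: le_trans yv; rewrite mulrC ler_pdivrMr //.
  by have := nsq_ge0 y; have := nsq_ge0 m; lra.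
move: pos; rewrite !ripE e1 => pos.
have := mulr_ge0 (ltW eta0) pos; lra.
Qed.

Lemma ker_adjoint_eq0 (S : set (H * K)) k :
  closure (ran S) = [set: K] -> adjoint S (k, 0) -> k = 0.
Proof.
move=> cS Sk; apply: nsq_eq0; rewrite /nsq /rip (@orth_closure _ _ (ran S)) ?cS //.
by move=> _ [[x y] Sxy <-]; rewrite (Sk _ _ Sxy) inner0r.
Qed.

Lemma adjoint_inj (S : set (H * K)) k l h :
  closure (ran S) = [set: K] -> adjoint S (k, h) -> adjoint S (l, h) -> k = l.
Proof.
move=> cS Sk Sl; apply/eqP; rewrite -subr_eq0; apply/eqP/(ker_adjoint_eq0 cS).
by rewrite -(subrr h); exact: (relationB (adjoint_linear S) Sk Sl).
Qed.

(** Domination of forms makes T x |-> D^{1/2} x a contraction G, and X represents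
    the form of A on ran T: <X T x, T x'> = <A x, x'>.  For x in dom A this says
    that T^* X T x = A x = B^* T x, and the core hypothesis extends
    T^* X = B^* from T (dom A) to dom B^*. *)
Lemma dominated_factor (eta : R) :
  closure (adjoint B `&` [set: K] `*` ran A) = adjoint B ->
  closure (ran T) = [set: K] -> closure (ran B) = [set: K] ->
  0 < eta -> op_ge (adjoint T \; T) (scale_op (eta%:C)%C A) ->
  ran (adjoint T) `<=` ran (adjoint B) ->
  exists Y : set (K * K),
    [/\ linear_relation Y, Bplus (Y^-1) & adjoint T = adjoint B \; Y].
Proof.
move=> core rT rB eta0 CD sub.
have [[Tl Top] cT dT] := T_cdd.
set C := adjoint T \; T in CD *; set D := scale_op _ _ in CD *.
have [nC nD _ _] := CD; move/(op_geP nC nD) in CD.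
set S := sqrt_op D in CD *.
have [[S0 sS] SS] := sqrt_opP nD; rewrite -/S in S0 sS SS.
have [[Sl _] _ _] := sS.
have TS x y : T (x, y) -> exists2 z, S (x, z) & nsq z <= nsq y.
  move=> Txy; have [|v Cxv vy] := @sqrt_op_domain _ _ C x (nsq y) nC.
    by move=> a w; exact: form_bound.
  by have [z Sz zv] := CD _ _ Cxv; exists z => //; exact: le_trans vy.
pose G : set (K * H) := [set p | exists2 x, T (x, p.1) & S (x, p.2)].
have Gl : linear_relation G.
  split=> [|c p q [x Tx Sx] [y Ty Sy]]; first by exists 0; [case: Tl | case: Sl].
  exists (c *: x + y); first exact: (Tl.2 c (x, p.1) (y, q.1)).
  exact: (Sl.2 c (x, p.2) (y, q.2)).
have Gc y z : G (y, z) -> nsq z <= nsq y.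
  move=> [x /= Txy Sxz]; have [z' Sz' zy] := TS _ _ Txy.
  by rewrite (sqrt_op_functional nD Sxz Sz').
have [|X0_Bplus aaop Gaa] := contraction_square Gl Gc.
  apply/seteqP; split=> // k _; have : closure (ran T) k by rewrite rT.
  apply: closure_subset => _ [[x y] Txy <-].
  by have [z Sz _] := TS _ _ Txy; exists (y, z) => //; exists x.
have ieta0 : 0 < eta^-1%R by rewrite invr_gt0.
set X0 := adjoint G \; _ in X0_Bplus.
pose X := scale_op ((eta^-1%R)%:C)%C X0.
have XB : Bplus X by exact: scale_op_Bplus.
have [dX _ [_ sX]] := XB; have [[Xl _] _ _] := sX.
have Xex k : exists l, X (k, l).
  have [[a l] Xal /= ak] : dom X k by rewrite dX.
  by exists l; rewrite -ak.
have TXA x y h l : T (x, y) -> adjoint B (y, h) -> X (y, l) -> adjoint T (l, h).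
  move=> Txy yh /(scale_opP _ _ _ ieta0); rewrite invrK => -[g /= yg gl].
  have : D (x, (eta%:C)%C *: h) by exists (x, h) => //; exists y.
  rewrite -SS => -[z /= Sxz Szh].
  have gz : g = z by apply: (operator_functional aaop yg); apply: Gaa; exists x.
  move=> x' y' Txy'; have [z' Sz' _] := TS _ _ Txy'.
  have /= := gl y' z' (ex_intro2 _ _ x' Txy' Sz').
  rewrite gz (selfadjoint_sym sS Sz' Szh) !innerZrr => /esym; apply: mulfI.
  by rewrite (fmorph_eq0 (real_complex R)) gt_eqF.
pose TX : set (H * K) := X \; T.
(* The adjoint of X T, which is closed, contains B_0: injectivity of B^*
   identifies an element k of dom B_0 with some T x, x in dom A. *)
have B_TX : adjoint B `<=` adjoint TX.
  rewrite -core (closure_id (adjoint TX)).1; last exact: adjoint_closed.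
  apply: closure_subset => -[k h] [Bkh [_ [[x h'] [y /= Txy yh'] e]]].
  rewrite /= in e; rewrite e in yh'.
  have ky := adjoint_inj rB Bkh yh'.
  have [m ym] := Xex y.
  move=> x' l' [y' /= Txy' yl'].
  by rewrite ky (selfadjoint_sym sX yl' ym) (TXA _ _ _ _ Txy yh' ym _ _ Txy').
(* X is bounded and symmetric, so the adjoint of X T is T^* X. *)
have BT k h m : adjoint B (k, h) -> X (k, m) -> adjoint T (m, h).
  move=> /B_TX kh km x y Txy; have [l yl] := Xex y.
  rewrite /= -(selfadjoint_sym sX yl km).
  by apply: kh; exists y.
exists (X^-1); split.
- split=> [|c p q Xp Xq]; first by case: Xl.
  exact: (Xl.2 c (p.2, p.1) (q.2, q.1)).
- by rewrite (_ : (X^-1)^-1 = X) //; apply/seteqP; split=> -[].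
- apply/seteqP; split=> [[p h] Tph|[p h] [k kp kh]]; last exact: BT kh kp.
  have [[k h'] kh /= e] := sub h (ex_intro2 _ _ _ Tph erefl).
  rewrite e in kh; have [m km] := Xex k.
  by exists k => //=; rewrite (adjoint_inj rT Tph (BT _ _ _ kh km)).
Qed.

End Main.

Theorem corollary3p6 (R : realType) (H K : hilbertType R) (T B : set (H * K)) :
  closed_densely_defined T ->
  closed_densely_defined B ->
  selfadjoint (adjoint B \; T) ->
  closure (adjoint B `&` [set: K] `*` ran (adjoint B \; T)) = adjoint B ->
  closure (ran T) = [set: K] ->
  closure (ran B) = [set: K] ->
  ((exists eta : R,
      [/\ 0 < eta,
          op_ge (adjoint T \; T) (scale_op (eta%:C)%C (adjoint B \; T)),
          op_ge (scale_op (eta%:C)%C (adjoint B \; T)) zero_op &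
          ran (adjoint T) `<=` ran (adjoint B)])
   <->
   (exists Y : set (K * K),
      [/\ linear_relation Y, Bplus (Y^-1) & adjoint T = adjoint B \; Y])).
Proof.
move=> T_cdd B_cdd A_sa core rT rB; split=> [[eta [eta0 TA _ sub]]|[Y [_ YB aT]]].
  exact: dominated_factor core rT rB eta0 TA sub.
have [eta eta0 [TA nA]] := factor_dominates T_cdd B_cdd A_sa YB aT.
exists eta; split=> //; first exact: op_ge_zero.
by move=> h [[p h'] + <-]; rewrite aT => -[l _ lh]; exists (l, h').
Qed.
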